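(* Let $\mathcal{I}=\{1,\dots,m\}$, $\mathcal{J}=\{1,\dots,n\}$, $\mathcal{K}=\{1,\dots,p\}$ be finite nonempty index sets. Let $a_{ij}\in\mathbb{R}^d$, $b_{ij}\in\mathbb{R}$ for $i\in\mathcal{I}$, $j\in\mathcal{J}$, and let $g(x)=\min_{i\in\mathcal{I}}g_i(x)$ with $g_i(x)=\max_{j\in\mathcal{J}}(a_{ij}^\top x+b_{ij})$, $x\in\mathbb{R}^d$. Let $X=\{x\in\mathbb{R}^d: c_k(x)\le0,\ k\in\mathcal{K}\}$, where each $c_k\colon\mathbb{R}^d\to\overline{\mathbb{R}}$ is a proper, closed, and convex function. Let $$p'=\inf_{\mu\in\mathcal{P}(X)}\mathbb{E}_{x'\sim\mu}\,g(x'),$$ let $\underline{c}$ be the optimal value of the problem $$\begin{aligned}\underset{\lambda_i,\eta_i\in\mathbb{R},\ x_i\in\mathbb{R}^d\ (i\in\mathcal{I})}{\text{minimize}}\quad&\sum_{i\in\mathcal{I}}\eta_i\\ \text{subject to}\quad&\mathscr{P}_{c_k}(x_i,\lambda_i)\le0,\quad i\in\mathcal{I},\ k\in\mathcal{K},\\&\mathscr{P}_{g_i}(x_i,\lambda_i)\le\eta_i,\quad i\in\mathcal{I},\\&\sum_{i\in\mathcal{I}}\lambda_i=1,\quad\lambda_i\ge0,\ i\in\mathcal{I},\end{aligned}$$ and let $\overline{c}$ be the optimal value of the problem $$\begin{aligned}\underset{\alpha,\beta_{ik}\in\mathbb{R},\ y_i,z_{ik}\in\mathbb{R}^d\ (i\in\mathcal{I},k\in\mathcal{K})}{\text{maximize}}\quad&-\alpha\\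 \text{subject to}\quad&g_i^*(y_i)+\sum_{k\in\mathcal{K}}\mathscr{P}_{c_k^*}(z_{ik},\beta_{ik})\le\alpha,\quad i\in\mathcal{I},\\&y_i+\sum_{k\in\mathcal{K}}z_{ik}=0,\quad i\in\mathcal{I},\\&\beta_{ik}\ge0,\quad i\in\mathcal{I},\ k\in\mathcal{K}.\end{aligned}$$ Assume that $X$ is bounded and that the optimization problem defining $\overline{c}$ admits a Slater point. Then $\underline{c}=p'=\overline{c}$, and, for every solution $(\eta^\star,\lambda^\star,x^\star)$ of the problem defining $\underline{c}$ (i.e., every feasible point attaining the optimal value), the discrete probability distribution $$\sum_{i\in\mathcal{I}:\ \lambda_i^\star\ne0}\lambda_i^\star\,\delta_{x_i^\star/\lambda_i^\star}$$ solves $p'$, i.e., it belongs to $\mathcal{P}(X)$ and attains the infimum defining $p'$.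
   Context: $\overline{\mathbb{R}}=\mathbb{R}\cup\{-\infty,\infty\}$ and $\mathbb{R}_+=[0,\infty)$. $\mathcal{P}(X)$ is the set of Borel probability measures on $X$; $\delta_x$ is the Dirac measure centered at $x$; $\mathbb{E}_{x'\sim\mu}g(x')=\int_X g\,d\mu$. The effective domain of $f\colon\mathbb{R}^d\to\overline{\mathbb{R}}$ is $\operatorname{dom}(f)=\{x: f(x)<\infty\}$. ''Closed'' means having closed epigraph (lower semicontinuous); ''proper'' means never $-\infty$ and not identically $+\infty$. $\operatorname{ri}$ denotes relative interior. Infima over the empty set are $+\infty$ and suprema over the empty set are $-\infty$. Conjugate: $f^*(y)=\sup_{x\in\operatorname{dom}(f)}(y^\top x-f(x))$ for $y\in\mathbb{R}^d$. Perspective: for a proper, closed, convex $f\colon\mathbb{R}^d\to\overline{\mathbb{R}}$, the perspective $\mathscr{P}_f\colon\mathbb{R}^d\times\mathbb{R}_+\to\overline{\mathbb{R}}$ is $\mathscr{P}_f(x,t)=t f(x/t)$ if $t>0$, and $\mathscr{P}_f(x,0)=\sup_{y\in\operatorname{dom}(f^* )}y^\top x$. When regarded as a function on all of $\mathbb{R}^d\times\mathbb{R}$, it is set to $+\infty$ for $t<0$. Slater point: for extended real-valued functions $f_0,f_1,\dots,f_M$ and $h_1,\dots,h_N$ on a Euclidean space $E$, the problem $\inf\{f_0(x): f_1(x)\le0,\dots,f_M(x)\le0,\ h_1(x)=0,\dots,h_N(x)=0,\ x\in E\}$ admits a Slater point if there exists $x\in\bigcap_{i=0}^M\operatorname{ri}(\operatorname{dom}(f_i))\cap\bigcap_{j=1}^N\operatorname{ri}(\operatorname{dom}(h_j))$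 such that $f_i(x)\le0$ for all $i\ne0$, $h_j(x)=0$ for all $j$, and $f_i(x)<0$ for all $i\ne0$ such that $f_i$ is nonlinear. For the problem defining $\overline{c}$, this is applied to the equivalent minimization of $f_0=\alpha$ over the joint variable $(\alpha,(\beta_{ik}),(y_i),(z_{ik}))$, with inequality constraint functions $g_i^*(y_i)+\sum_{k}\mathscr{P}_{c_k^*}(z_{ik},\beta_{ik})-\alpha$ (for $i\in\mathcal{I}$) and $-\beta_{ik}$ (for $i\in\mathcal{I}$, $k\in\mathcal{K}$), and equality constraint functions the components of $y_i+\sum_{k}z_{ik}$. *)

(* Defs.v *)
From HB Require Import structures.
From mathcomp Require Import all_boot all_order all_algebra.
From mathcomp Require Import all_classical all_reals all_analysis.

Set Implicit Arguments.
Unset Strict Implicit.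
Unset Printing Implicit Defensive.

Import Order.TTheory GRing.Theory Num.Theory.
Import numFieldNormedType.Exports.

Local Open Scope classical_set_scope.
Local Open Scope ring_scope.
Local Open Scope ereal_scope.

(* Vectors of R^d are row vectors.  Their library norm is the sup norm, which
   has the same bounded sets and the same topology as the Euclidean norm. *)

Definition dot {R : realType} {d : nat} (u v : 'rV[R]_d) : R :=
  (\sum_(l < d) u 0 l * v 0 l)%R.

Definition dom {R : realType} {E : Type} (f : E -> \bar R) : set E :=
  [set x | f x < +oo].

Definition epigraph {R : realType} {E : normedModType R} (f : E -> \bar R) :
    set (E * R^o)%type :=
  [set xr | f xr.1 <= (xr.2 : R)%:E].

Definition proper_fun {R : realType} {E : Type} (f : E -> \bar R) : Prop :=
  (forall x, f x != -oo) /\ exists x, f x != +oo.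

Definition closed_fun {R : realType} {E : normedModType R}
  (f : E -> \bar R) : Prop := closed (epigraph f).

Definition convex_fun {R : realType} {E : normedModType R}
  (f : E -> \bar R) : Prop := convex_set (epigraph f).

Definition conjugate {R : realType} {d : nat} (f : 'rV[R]_d -> \bar R)
    (y : 'rV[R]_d) : \bar R :=
  ereal_sup [set (dot y x)%:E - f x | x in dom f].

Definition perspective {R : realType} {d : nat} (f : 'rV[R]_d -> \bar R)
    (x : 'rV[R]_d) (t : R) : \bar R :=
  if (0 < t)%R then t%:E * f (t^-1 *: x)%R
  else if t == 0%R then ereal_sup [set (dot y x)%:E | y in dom (conjugate f)]
  else +oo.

Definition affine_set {R : realType} {E : normedModType R} (A : set E) : Prop :=
  forall x y (t : R), A x -> A y -> A ((1 - t) *: x + t *: y)%R.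

Definition affine_hull {R : realType} {E : normedModType R} (C : set E) :
  set E := smallest affine_set C.

Definition relint {R : realType} {E : normedModType R} (C : set E) : set E :=
  [set x | affine_hull C x /\ \forall y \near x, affine_hull C y -> C y].

(* "Linear" has its meaning from optimization: a constant term is allowed. *)
Definition linear_fun {R : realType} {E : normedModType R}
    (f : E -> \bar R) : Prop :=
  exists (l : {linear E -> R^o}) (r : R), forall x, f x = ((l x : R) + r)%:E.

Definition slater_point {R : realType} {E : normedModType R} {I J : finType}
    (f0 : E -> \bar R) (f : I -> E -> \bar R) (h : J -> E -> \bar R)
    (x : E) : Prop :=
  [/\ relint (dom f0) x,
      forall i, relint (dom (f i)) x & forall j, relint (dom (h j)) x] /\
  [/\ forall i, f i x <= 0,
      forall j, h j x = 0 &
      forall i, ~ linear_fun (f i) -> f i x < 0].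

(* R^d with its Borel sigma-algebra, generated by the open sets. *)
Definition borel_space (R : realType) (d : nat) :=
  g_sigma_algebraType (@open 'rV[R]_d).

(* Borel probability measures on X, seen as the Borel probability measures on
   R^d carried by X (the sets X considered here are closed). *)
Definition probabilities_on {R : realType} {d : nat} (X : set 'rV[R]_d) :
    set (probability (borel_space R d) R) :=
  [set mu | mu X = 1].

Definition moment_value {R : realType} {d : nat} (X : set 'rV[R]_d)
    (g : 'rV[R]_d -> \bar R) : \bar R :=
  ereal_inf [set \int[mu]_(x in X) g x | mu in probabilities_on X].

Definition moment_solution {R : realType} {d : nat} (X : set 'rV[R]_d)
    (g : 'rV[R]_d -> \bar R) (mu : probability (borel_space R d) R) : Prop :=
  probabilities_on X mu /\ \int[mu]_(x in X) g x = moment_value X g.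

Definition max_affine {R : realType} {d n : nat} (a : 'I_n -> 'rV[R]_d)
    (b : 'I_n -> R) (x : 'rV[R]_d) : \bar R :=
  \big[maxe/-oo]_(j < n) (dot (a j) x + b j)%:E.

Definition min_fun {R : realType} {d m : nat} (g : 'I_m -> 'rV[R]_d -> \bar R)
    (x : 'rV[R]_d) : \bar R :=
  \big[mine/+oo]_(i < m) g i x.

Definition sublevel {R : realType} {d p : nat}
    (c : 'I_p -> 'rV[R]_d -> \bar R) : set 'rV[R]_d :=
  [set x | forall k, c k x <= 0].

Definition lower_feasible {R : realType} {d m p : nat}
    (g : 'I_m -> 'rV[R]_d -> \bar R) (c : 'I_p -> 'rV[R]_d -> \bar R)
    (eta lam : 'I_m -> R) (x : 'I_m -> 'rV[R]_d) : Prop :=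
  [/\ forall i k, perspective (c k) (x i) (lam i) <= 0,
      forall i, perspective (g i) (x i) (lam i) <= (eta i)%:E,
      (\sum_(i < m) lam i = 1)%R &
      forall i, (0 <= lam i)%R].

Definition lower_value {R : realType} {d m p : nat}
    (g : 'I_m -> 'rV[R]_d -> \bar R) (c : 'I_p -> 'rV[R]_d -> \bar R) :
    \bar R :=
  ereal_inf [set v | exists eta lam x,
    lower_feasible g c eta lam x /\ v = (\sum_(i < m) eta i)%R%:E].

Definition lower_solution {R : realType} {d m p : nat}
    (g : 'I_m -> 'rV[R]_d -> \bar R) (c : 'I_p -> 'rV[R]_d -> \bar R)
    (eta lam : 'I_m -> R) (x : 'I_m -> 'rV[R]_d) : Prop :=
  lower_feasible g c eta lam x /\
  (\sum_(i < m) eta i)%R%:E = lower_value g c.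

(* The joint variable (alpha, beta, y, z): beta_ik is an entry, y_i is row i,
   and z_ik is the row of index mxvec_index i k. *)
Definition upper_space (R : realType) (d m p : nat) : normedModType R :=
  (R^o * 'M[R]_(m, p) * 'M[R]_(m, d) * 'M[R]_(m * p, d))%type.

Definition ualpha {R : realType} {d m p : nat} (w : upper_space R d m p) : R :=
  w.1.1.1.

Definition ubeta {R : realType} {d m p : nat} (w : upper_space R d m p)
  (i : 'I_m) (k : 'I_p) : R := w.1.1.2 i k.

Definition uy {R : realType} {d m p : nat} (w : upper_space R d m p)
  (i : 'I_m) : 'rV[R]_d := row i w.1.2.

Definition uz {R : realType} {d m p : nat} (w : upper_space R d m p)
  (i : 'I_m) (k : 'I_p) : 'rV[R]_d := row (mxvec_index i k) w.2.

Definition upper_feasible {R : realType} {d m p : nat}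
    (g : 'I_m -> 'rV[R]_d -> \bar R) (c : 'I_p -> 'rV[R]_d -> \bar R)
    (w : upper_space R d m p) : Prop :=
  [/\ forall i, conjugate (g i) (uy w i) +
        \sum_(k < p) perspective (conjugate (c k)) (uz w i k) (ubeta w i k)
        <= (ualpha w)%:E,
      forall i, (uy w i + \sum_(k < p) uz w i k = 0)%R &
      forall i k, (0 <= ubeta w i k)%R].

Definition upper_value {R : realType} {d m p : nat}
    (g : 'I_m -> 'rV[R]_d -> \bar R) (c : 'I_p -> 'rV[R]_d -> \bar R) :
    \bar R :=
  ereal_sup [set (- ualpha w)%R%:E | w in upper_feasible g c].

Definition upper_ineq {R : realType} {d m p : nat}
    (g : 'I_m -> 'rV[R]_d -> \bar R) (c : 'I_p -> 'rV[R]_d -> \bar R)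
    (s : 'I_m + 'I_m * 'I_p) (w : upper_space R d m p) : \bar R :=
  match s with
  | inl i => conjugate (g i) (uy w i) +
      \sum_(k < p) perspective (conjugate (c k)) (uz w i k) (ubeta w i k)
      - (ualpha w)%:E
  | inr (i, k) => (- ubeta w i k)%R%:E
  end.

Definition upper_eq {R : realType} {d m p : nat} (s : 'I_m * 'I_d)
    (w : upper_space R d m p) : \bar R :=
  ((uy w s.1 + \sum_(k < p) uz w s.1 k) 0 s.2)%R%:E.

Definition upper_slater {R : realType} {d m p : nat}
    (g : 'I_m -> 'rV[R]_d -> \bar R) (c : 'I_p -> 'rV[R]_d -> \bar R) : Prop :=
  exists w : upper_space R d m p,
    slater_point (fun v => (ualpha v)%:E) (upper_ineq g c) upper_eq w.

(* Main.v *)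
(* p' is the infimum of g over X: Dirac measures give one inequality,
   integration of a lower bound the other.  A feasible point of the
   lower problem is a discrete measure on X: when lambda_i = 0 the constraints
   make x_i a recession direction of X, so x_i = 0 by boundedness and eta_i >= 0.
   This gives the lower value and the statement on solutions.

   For the upper problem, the constraints decouple over i.  Fix i and suppose
   v < g_i on X.  The attainable pairs (y + sum_k z_k, alpha) form a convex set K
   of R^d x R.  If (0, -v) were not in K, separate it properly from K.  A
   separating hyperplane that is not vertical yields by Fenchel-Moreau a point x
   of X with g_i(x) <= v.  A vertical one contradicts the Slater point, from which
   every segment into the domain of the constraint can be prolonged a little. *)

Require Import Defs.
From HB Require Import structures.
From mathcomp Require Import all_boot all_order all_algebra.
From mathcomp Require Import all_classical all_reals all_analysis.
From mathcomp Require Import measurable_realfun.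
From mathcomp Require Import ring lra.
Import Order.TTheory GRing.Theory Num.Theory.
Import numFieldNormedType.Exports.
Local Open Scope classical_set_scope.
Local Open Scope ring_scope.
Local Open Scope ereal_scope.

(** * Separation of convex sets in R^n *)

Section separation.
Set Implicit Arguments.
Unset Strict Implicit.
Local Open Scope ring_scope.
Variable R : realType.

Lemma dotC n (u v : 'rV[R]_n) : dot u v = dot v u.
Proof. by apply: eq_bigr => i _; rewrite mulrC. Qed.

Lemma dotDr n (u v w : 'rV[R]_n) : dot u (v + w) = dot u v + dot u w.
Proof. by rewrite -big_split; apply: eq_bigr => i _; rewrite mxE mulrDr. Qed.

Lemma dotDl n (u v w : 'rV[R]_n) : dot (v + w) u = dot v u + dot w u.
Proof. by rewrite !(dotC _ u) dotDr. Qed.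

Lemma dotZr n (u v : 'rV[R]_n) t : dot u (t *: v) = t * dot u v.
Proof. by rewrite mulr_sumr; apply: eq_bigr => i _; rewrite mxE mulrCA. Qed.

Lemma dotZl n (u v : 'rV[R]_n) t : dot (t *: v) u = t * dot v u.
Proof. by rewrite !(dotC _ u) dotZr. Qed.

Lemma dot0r n (u : 'rV[R]_n) : dot u 0 = 0.
Proof. by rewrite -(scale0r 0) dotZr mul0r. Qed.

Lemma dot0l n (u : 'rV[R]_n) : dot 0 u = 0.
Proof. by rewrite dotC dot0r. Qed.

Lemma dotNr n (u v : 'rV[R]_n) : dot u (- v) = - dot u v.
Proof. by rewrite -scaleN1r dotZr mulN1r. Qed.

Lemma dotNl n (u v : 'rV[R]_n) : dot (- v) u = - dot v u.
Proof. by rewrite !(dotC _ u) dotNr. Qed.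

Lemma dotBr n (u v w : 'rV[R]_n) : dot u (v - w) = dot u v - dot u w.
Proof. by rewrite dotDr dotNr. Qed.

Lemma dot_sumr n (u : 'rV[R]_n) (I : Type) (r : seq I) (P : pred I)
    (F : I -> 'rV[R]_n) :
  dot u (\sum_(i <- r | P i) F i) = \sum_(i <- r | P i) dot u (F i).
Proof.
elim/big_rec2: _ => [|i y1 y2 _ <-]; first exact: dot0r.
exact: dotDr.
Qed.

Lemma dot_row_mx n1 n2 (u v : 'rV[R]_n1) (r s : 'rV[R]_n2) :
  dot (row_mx u r) (row_mx v s) = dot u v + dot r s.
Proof.
rewrite /dot big_split_ord/=; congr (_ + _); apply: eq_bigr => i _.
  by rewrite !row_mxEl.
by rewrite !row_mxEr.
Qed.

Lemma dot_row_scalar_mx n (l : 'rV[R]_(n + 1)) (u : 'rV[R]_n) (r : R) :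
  dot l (row_mx u r%:M) = dot (lsubmx l) u + rsubmx l 0 0 * r.
Proof.
rewrite -{1}(hsubmxK l) dot_row_mx; congr (_ + _).
by rewrite /dot big_ord1 !mxE eqxx mulr1n.
Qed.

Lemma dotvv_ge0 n (u : 'rV[R]_n) : 0 <= dot u u.
Proof. by apply: sumr_ge0 => i _; rewrite -expr2 sqr_ge0. Qed.

Lemma dotvv_eq0 n (u : 'rV[R]_n) : (dot u u == 0) = (u == 0).
Proof.
apply/eqP/eqP => [/eqP|->]; last exact: dot0r.
rewrite psumr_eq0; last by move=> i _; rewrite -expr2 sqr_ge0.
move=> /allP u0; apply/rowP => i; rewrite mxE; apply/eqP.
by have := u0 i (mem_index_enum _); rewrite /= mulf_eq0 orbb.
Qed.

Lemma sum_continuous (T : topologicalType) (I : Type) (r : seq I) (F : I -> T -> R) :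
  (forall i, continuous (F i)) -> continuous (fun x => \sum_(i <- r) F i x).
Proof.
move=> cF; elim: r => [|i r IH] x.
  by under eq_fun do rewrite big_nil; exact: cvg_cst.
by under eq_fun do rewrite big_cons; apply: continuousD; [exact: cF|exact: IH].
Qed.

Lemma dot_continuous n (u : 'rV[R]_n) : continuous (dot u).
Proof.
apply: (@sum_continuous 'rV[R]_n _ _ (fun l v => u 0 l * v 0 l)) => l x.
by apply: continuousM; [exact: cst_continuous | exact: coord_continuous].
Qed.

Lemma dotvv_continuous n : continuous (fun u : 'rV[R]_n => dot u u).
Proof.
apply: (@sum_continuous 'rV[R]_n _ _ (fun l v => v 0 l * v 0 l)) => l x.
by apply: continuousM; exact: coord_continuous.
Qed.

Lemma mx_entry_le n (v : 'rV[R]_n) i : `|v 0 i| <= `|v|.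
Proof.
rewrite [leRHS]/Num.norm /= mx_normrE; apply/bigmax_geP; right => /=.
by exists (0, i).
Qed.

Lemma mx_norm_le n (v : 'rV[R]_n) M :
  0 <= M -> (forall i, `|v 0 i| <= M) -> `|v| <= M.
Proof.
move=> M0 vM; rewrite [leLHS]/Num.norm /= mx_normrE; apply/bigmax_leP; split => //.
by move=> [i j] _ /=; rewrite (ord1 i).
Qed.

Lemma dotvv_bounded n (M : R) : bounded_set [set v : 'rV[R]_n | dot v v <= M].
Proof.
exists (M + 1); split; first exact: num_real.
move=> K MK v /= vM.
have K0 : 0 <= K.
  by rewrite (le_trans _ (ltW MK))// addr_ge0// (le_trans (dotvv_ge0 v)).
apply: mx_norm_le => // i; rewrite real_leNgt ?num_real//; apply/negP => vK.
have : `|v 0 i| ^+ 2 <= M.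
  rewrite real_normK ?num_real//; apply: le_trans vM.
  rewrite /dot (bigD1 i)//= -expr2 lerDl; apply: sumr_ge0 => j _.
  by rewrite -expr2 sqr_ge0.
have := sqr_ge0 (`|v 0 i| - 1); move: (`|v 0 i|) vK => x; nra.
Qed.

Lemma dotvv_compact n (M : R) : compact [set v : 'rV[R]_n | dot v v <= M].
Proof.
apply: bounded_closed_compact; first exact: dotvv_bounded.
have := @preimage_closed _ _ (fun v : 'rV[R]_n => dot v v) [set x | x <= M].
apply; first by move=> x _; exact: dotvv_continuous.
exact: closed_le.
Qed.

(** Only the part of [A] inside the ball through one of its points matters, and that part is
    compact. *)
Lemma exists_closest n (A : set 'rV[R]_n) : closed A -> A !=set0 ->
  exists2 a0, A a0 & forall a, A a -> dot a0 a0 <= dot a a.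
Proof.
move=> cA [a Aa].
have cB : compact (A `&` [set v | dot v v <= dot a a]).
  rewrite setIC; apply: compact_closedI => //; exact: dotvv_compact.
have [||b] := EVT_min_rV (f := fun v : 'rV[R]_n => dot v v) _ cB.
- by exists a; split => /=.
- by apply: continuous_subspaceT; exact: dotvv_continuous.
rewrite inE => -[Ab /= ba] bmin; exists b => // x Ax.
have [xa|/ltW ax] := leP (dot x x) (dot a a); last exact: le_trans ax.
by apply: bmin; rewrite inE.
Qed.

(** Replaces the interval-typed coefficient of [convex_set] by a real with explicit bounds. *)
Lemma convex_setP (M : lmodType R) (A : set M) :
  @convex_set R M A <-> forall x y (t : R), 0 <= t -> t <= 1 -> A x -> A y ->
    A (t *: x + (1 - t) *: y).
Proof.
split=> [cA x y t t0 t1 Ax Ay|cA x y t].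
  have t01 : Itv.spec (@Itv.num_sem R) (Itv.Real `[0%Z, 1%Z]) t.
    by apply/andP; split; rewrite ?num_real//= in_itv/= t0 t1.
  have /set_mem := cA x y (Itv.mk t01) (mem_set Ax) (mem_set Ay).
  by [].
move=> /set_mem Ax /set_mem Ay; apply/mem_set.
by apply: cA.
Qed.

(** If [dot a0 (a - a0)] were negative, a small step from [a0] towards [a] would shorten the
    vector. *)
Lemma convex_obtuse n (A : set 'rV[R]_n) a0 :
  @convex_set R 'rV[R]_n A -> A a0 -> (forall a, A a -> dot a0 a0 <= dot a a) ->
  forall a, A a -> dot a0 a0 <= dot a0 a.
Proof.
move=> /convex_setP cA Aa0 a0min a Aa; rewrite -subr_ge0 leNgt; apply/negP.
set w := a - a0; have wE : a = w + a0 by rewrite subrK.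
clearbody w; rewrite {1}wE dotDr addrK => w0.
have q0 := dotvv_ge0 w; set q := dot w w in q0; set e := dot a0 w in w0.
(* This [t] lies in (0, 1] and satisfies [t * q < - e], so the change [t * (2 * e + t * q)] of the
   squared length is negative. *)
pose t := - e / (1 + q - e).
have D0 : 0 < 1 + q - e by lra.
have t0 : 0 < t by rewrite divr_gt0// oppr_gt0.
have t1 : t <= 1 by rewrite ler_pdivrMr//; lra.
have /a0min := cA _ _ _ (ltW t0) t1 Aa Aa0.
have -> : t *: a + (1 - t) *: a0 = a0 + t *: w.
  by rewrite wE scalerDr scalerBl scale1r -addrA [X in _ + X]addrCA subrr addr0 addrC.
rewrite !(dotDr, dotDl, dotZr, dotZl) (dotC w a0) -/e -/q.
have tD : t * (1 + q - e) = - e by rewrite /t divfK// gt_eqF.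
nra.
Qed.

(** Once [q] is translated to the origin, the point of least norm is the normal and its squared norm
    the gap. *)
Lemma strict_separation n (A : set 'rV[R]_n) q :
  @convex_set R 'rV[R]_n A -> closed A -> A !=set0 -> ~ A q ->
  exists l e, 0 < e /\ forall a, A a -> dot l q + e <= dot l a.
Proof.
move=> cvA clA [a Aa] nAq.
pose B := [set v | A (v + q)].
have clB : closed B.
  apply: (@preimage_closed 'rV[R]_n 'rV[R]_n (fun v => v + q) A) => // v _.
  by apply: continuousD => //; exact: cst_continuous.
have cvB : @convex_set R 'rV[R]_n B.
  apply/convex_setP => x y t t0 t1 Bx By; rewrite /B /=.
  have -> : t *: x + (1 - t) *: y + q = t *: (x + q) + (1 - t) *: (y + q).
    rewrite !scalerDr addrACA; congr (_ + _).
    by rewrite -scalerDl addrC subrK scale1r.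
  by move/convex_setP : cvA; apply.
have [|b0 Bb0 b0min] := exists_closest clB; first by exists (a - q); rewrite /B /= subrK.
exists b0, (dot b0 b0); split.
  rewrite lt_def dotvv_ge0 dotvv_eq0 andbT; apply: contra_notN nAq => /eqP b00.
  by move: Bb0; rewrite b00 /B /= add0r.
move=> x Ax; have := @convex_obtuse _ _ _ cvB Bb0 b0min (x - q).
rewrite /B /= subrK dotBr => /(_ Ax); lra.
Qed.

Lemma convex_comb n (C : set 'rV[R]_n) (I : Type) (r : seq I) (t : I -> R)
    (F : I -> 'rV[R]_n) :
  @convex_set R 'rV[R]_n C -> (forall i, 0 <= t i) -> (forall i, C (F i)) ->
  \sum_(i <- r) t i = 1 -> C (\sum_(i <- r) t i *: F i).
Proof.
move=> /convex_setP cC t0 CF t1.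
(* The total weight is left arbitrary for the induction, since the weights of a tail need not sum to
   1. *)
suff [c Cc ->] : exists2 c, C c & \sum_(i <- r) t i *: F i = (\sum_(i <- r) t i) *: c.
  by rewrite t1 scale1r.
move: t1; case: r => [|i0 r _]; first by rewrite big_nil => /esym/eqP; rewrite oner_eq0.
elim: r i0 => [|i r IH] j; first by exists (F j); rewrite ?big_seq1.
have [c Cc] := IH i; rewrite [X in _ -> exists2 _, _ & X = _]big_cons => ->.
rewrite [X in exists2 _, _ & _ = X *: _]big_cons.
have : 0 <= \sum_(l <- i :: r) t l by apply: sumr_ge0.
move: (\sum_(l <- i :: r) t l) => s s0.
have [ts0|ts0] := eqVneq (t j + s) 0.
  exists c => //.
  have [-> ->] : t j = 0 /\ s = 0 by have := t0 j; split; lra.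
  by rewrite !addr0 !scale0r addr0.
have tsp : 0 < t j + s by rewrite lt_def ts0 addr_ge0.
exists ((t j / (t j + s)) *: F j + (1 - t j / (t j + s)) *: c).
  apply: cC => //; first by rewrite divr_ge0// ltW.
  by rewrite ler_pdivrMr// mul1r lerDl.
rewrite scalerDr !scalerA mulrBr mulr1 mulrCA divff// mulr1.
by rewrite (addrC (t j)) addrK.
Qed.

(** The convex hull of finitely many points is compact even if [C] is not closed; [v] is its
    normalized point of least norm. That a multiple of [v] lies in [C] keeps [v] in the span of [C]
    when passing to a limit. *)
Lemma finite_separation n (C : set 'rV[R]_n) k (F : 'I_k.+1 -> 'rV[R]_n) :
  @convex_set R 'rV[R]_n C -> ~ C 0 -> (forall i, C (F i)) ->
  exists2 v, (exists s, C (s *: v)) & dot v v = 1 /\ forall i, 0 <= dot v (F i).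
Proof.
move=> cvC nC0 CF.
pose h (t : 'rV[R]_k.+1) := \sum_i t 0 i *: F i.
pose D := [set t : 'rV[R]_k.+1 | (forall i, 0 <= t 0 i) /\ \sum_i t 0 i = 1].
have D0 : D (delta_mx 0 0).
  split=> [i|]; first by rewrite mxE ler0n.
  rewrite (bigD1 0)//= big1 ?addr0 => [|i i0]; first by rewrite mxE !eqxx.
  by rewrite mxE (negbTE i0) andbF.
have cD : compact D.
  have -> : D = (fun t : 'rV[R]_k.+1 => \sum_i t 0 i) @^-1` [set x | x = 1] `&`
      \bigcap_i ((fun t : 'rV[R]_k.+1 => t 0 i) @^-1` [set x | 0 <= x]).
    apply/seteqP; split => t [] /=; first by move=> h1 h2; split=> // i _; exact: h1.
    by move=> h1 h2; split => // i; exact: h2 i I.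
  apply: bounded_closed_compact.
    exists 1; split => // M M1 t [t1 t0]; apply: mx_norm_le => [|i].
      by rewrite (le_trans _ (ltW M1)).
    rewrite ger0_norm ?(t0 i I)// (le_trans _ (ltW M1))// -[leRHS]t1 (bigD1 i)//=.
    by rewrite lerDl; apply: sumr_ge0 => j _; exact: t0 j I.
  apply: closedI.
    apply: preimage_closed; last exact: closed_eq.
    move=> t _; apply: (@sum_continuous 'rV[R]_k.+1 _ _ (fun i t => t 0 i)) => i.
    exact: coord_continuous.
  apply: closed_bigI => i _; apply: preimage_closed; last exact: closed_ge.
  by move=> t _; exact: coord_continuous.
have hc : continuous (fun t => dot (h t) (h t)).
  have -> : (fun t => dot (h t) (h t)) = (fun t : 'rV[R]_k.+1 =>
      \sum_(l < n) (\sum_i t 0 i * F i 0 l) * (\sum_i t 0 i * F i 0 l)).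
    apply/funext => t; apply: eq_bigr => l _; rewrite /h summxE.
    by congr (_ * _); apply: eq_bigr => i _; rewrite mxE.
  apply: (@sum_continuous 'rV[R]_k.+1 _ _ (fun l t =>
    (\sum_i t 0 i * F i 0 l) * (\sum_i t 0 i * F i 0 l))) => l t.
  apply: continuousM;
    apply: (@sum_continuous 'rV[R]_k.+1 _ _ (fun i t => t 0 i * F i 0 l)) => i {}t;
    by apply: continuousM; [exact: coord_continuous|exact: cst_continuous].
have [||t /set_mem[t0 t1] tmin] := EVT_min_rV (f := fun t => dot (h t) (h t)) _ cD.
- by exists (delta_mx 0 0).
- exact: continuous_subspaceT.
have cvA : @convex_set R 'rV[R]_n (h @` D).
  apply/convex_setP => _ _ s s0 s1 [u [u0 u1] <-] [v [v0 v1] <-].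
  exists (s *: u + (1 - s) *: v); last first.
    rewrite /h !scaler_sumr -big_split; apply: eq_bigr => i _ /=.
    by rewrite !mxE !scalerA -scalerDl.
  split=> [i|]; first by rewrite !mxE addr_ge0// mulr_ge0// subr_ge0.
  under eq_bigr do rewrite !mxE.
  by rewrite big_split -!mulr_sumr/= u1 v1 !mulr1 addrC subrK.
have Cht : C (h t) by apply: convex_comb.
have htF i : dot (h t) (h t) <= dot (h t) (F i).
  apply: (@convex_obtuse _ (h @` D)) => //.
  - by exists t.
  - by move=> _ [u Du <-]; apply: tmin; rewrite inE.
  exists (delta_mx 0 i).
    split=> [j|]; first by rewrite mxE ler0n.
    rewrite (bigD1 i)//= big1 ?addr0 => [|j ji]; first by rewrite mxE !eqxx.
    by rewrite mxE (negbTE ji) andbF.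
  rewrite /h (bigD1 i)//= big1 ?addr0 => [|j ji]; first by rewrite mxE !eqxx scale1r.
  by rewrite mxE (negbTE ji) andbF scale0r.
have ht0 : 0 < dot (h t) (h t).
  rewrite lt_def dotvv_ge0 dotvv_eq0 andbT; apply: contra_notN nC0 => /eqP <-//.
pose s := Num.sqrt (dot (h t) (h t)).
have s0 : 0 < s by rewrite sqrtr_gt0.
exists (s^-1 *: h t); first by exists s; rewrite scalerA divff ?scale1r// gt_eqF.
split; last by move=> i; rewrite dotZl mulr_ge0 ?invr_ge0 ?(ltW s0)// (le_trans (ltW ht0)).
by rewrite dotZl dotZr -(sqr_sqrtr (ltW ht0)) -/s expr2 mulKf ?mulVf ?gt_eqF.
Qed.

(* The finite separations have a cluster point on the unit sphere; staying in
   the bipolar of [C], a closed subspace, it cannot vanish on all of [C]. *)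
Lemma proper_separation n (C : set 'rV[R]_n) :
  @convex_set R 'rV[R]_n C -> C !=set0 -> ~ C 0 ->
  exists2 l, (forall c, C c -> 0 <= dot l c) & exists2 c, C c & 0 < dot l c.
Proof.
move=> cvC [c0 Cc0] nC0.
pose L := [set v | forall l, (forall c, C c -> dot l c = 0) -> dot l v = 0].
pose S := [set v : 'rV[R]_n | dot v v = 1] `&` L.
have clL : closed L.
  have -> : L = \bigcap_(l in [set l | forall c, C c -> dot l c = 0])
      (dot l @^-1` [set x | x = 0]) by [].
  apply: closed_bigI => l _; apply: preimage_closed; last exact: closed_eq.
  by move=> v _; exact: dot_continuous.
have cS : compact S.
  apply: (subclosed_compact _ (@dotvv_compact n 1)).
    apply: closedI => //.
    apply: (@preimage_closed 'rV[R]_n R (fun v => dot v v) [set x | x = 1]) => //.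
    by move=> v _; exact: dotvv_continuous.
  by move=> v [/= -> _].
have := cS; rewrite compact_In0 => /(_ _ C (fun c => S `&` [set v | 0 <= dot v c])).
case.
- exists (fun c => [set v | 0 <= dot v c]) => // c _.
  under eq_fun do rewrite dotC.
  apply: (@preimage_closed _ _ (dot c) [set x | 0 <= x]); last exact: closed_ge.
  by move=> v _; exact: dot_continuous.
- move=> D' D'C.
  pose r := c0 :: finmap.enum_fset D'.
  have Cr i : (i < size r)%N -> C (nth 0 r i).
    move=> ir; have := mem_nth 0 ir; rewrite inE => /predU1P[->//|].
    by move=> /D'C /set_mem.
  have [v [s Csv] [v1 vF]] := finite_separation (F := fun i : 'I_(size r) => nth 0 r i)
    cvC nC0 (fun i => Cr i (ltn_ord i)).
  exists v => c /= cD'.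
  have Sv : S v.
    (* [s] is nonzero because [C] avoids the origin, so a form vanishing on [C] also vanishes at
       [v]. *)
    split=> // l lC; have := lC _ Csv; rewrite dotZr => /eqP.
    rewrite mulf_eq0 => /orP[/eqP s0|/eqP//].
    by move: Csv; rewrite s0 scale0r.
  split=> //=.
  have cr : c \in r by rewrite inE cD' orbT.
  have ir : (index c r < size r)%N by rewrite index_mem.
  by have := vF (Ordinal ir); rewrite /= nth_index.
- move=> l lC; have [[/= l1 Ll] _] := lC _ Cc0.
  exists l => [c /lC[]//|].
  (* If [l] vanished on [C], membership in [L] would make it orthogonal to itself. *)
  apply: contrapT => nl; have : dot l l = 0.
    apply: Ll => c Cc; have [_ /= lc] := lC _ Cc.
    apply/eqP; rewrite eq_le lc andbT leNgt; apply/negP => ?.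
    by apply: nl; exists c.
  by rewrite l1 => /eqP; rewrite oner_eq0.
Qed.

End separation.

(** * Conjugates and perspectives of closed convex functions *)

Section conjugates.
Set Implicit Arguments.
Unset Strict Implicit.
Local Open Scope ring_scope.
Variables (R : realType) (d : nat).
Implicit Types (f : 'rV[R]_d -> \bar R) (x y z : 'rV[R]_d).

(** Quantifying over epigraph points keeps the arithmetic real. It also covers [f x = -oo], where
    every [r] is admissible and both sides fail. *)
Lemma conjugate_le f y s :
  (conjugate f y <= s%:E)%E <->
  forall x r, (f x <= r%:E)%E -> dot y x - s <= r.
Proof.
split=> [fys x r fxr|fys].
  have : ((dot y x)%:E - f x <= s%:E)%E.
    apply: le_trans fys; apply: ereal_sup_ubound; exists x => //.
    by rewrite /dom /= (le_lt_trans fxr) ?ltry.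
  case: (f x) fxr => [t| |].
  - by rewrite -EFinB !lee_fin; lra.
  - by rewrite leye_eq.
  - by rewrite addey// leye_eq.
apply: ge_ereal_sup => _ [x /= fx <-]; rewrite /dom /= in fx.
case: (f x) (fys x) fx => [t| |]//=.
  by move=> /(_ t (lexx _)) h _; rewrite lee_fin; lra.
by move=> /(_ (dot y x - s - 1) (leNye _)) h; exfalso; lra.
Qed.

Section proper_closed_convex.
Variable f : 'rV[R]_d -> \bar R.
Hypothesis f_proper : proper_fun f.

Lemma proper_finite : exists x r, f x = r%:E.
Proof.
case: f_proper => fN [x]; have := fN x.
by case E : (f x) => [r| |]// _ _; exists x, r.
Qed.

Lemma conjugate_gtNy y : (-oo < conjugate f y)%E.
Proof.
have [x [r fx]] := proper_finite; rewrite ltNye; apply/eqP => cN.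
have : (conjugate f y <= (dot y x - r - 1)%:E)%E by rewrite cN leNye.
by move=> /conjugate_le/(_ x r); rewrite fx lexx => /(_ isT); lra.
Qed.

Hypotheses (f_closed : closed_fun f) (f_convex : convex_fun f).

(** The point [(x, r)] lies outside the closed convex epigraph, and [t] is nonnegative because the
    epigraph is unbounded upwards. *)
Lemma epigraph_separation x r : (r%:E < f x)%E -> exists y t e,
  [/\ 0 < e, 0 <= t & forall x' r', (f x' <= r'%:E)%E ->
      dot y x + t * r + e <= dot y x' + t * r'].
Proof.
move=> rfx.
pose h (v : 'rV[R]_(d + 1)) : ('rV[R]_d * R^o)%type := (lsubmx v, rsubmx v 0 0).
have hE x' r' : h (row_mx x' r'%:M) = (x', r').
  by rewrite /h row_mxKl row_mxKr mxE eqxx mulr1n.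
pose A := h @^-1` epigraph f.
have lc : continuous (fun v : 'rV[R]_(d + 1) => lsubmx v : 'rV[R]_d).
  move=> v.
  apply/(@pseudometric_normed_Zmodule.cvgrPdist_lt _ _ _ _ (nbhs_filter v)) => e e0.
  apply/(@nbhs_normP R 'rV[R]_(d + 1)); exists e => //= w vw.
  apply: le_lt_trans vw.
  apply: mx_norm_le => // i; rewrite -linearB/= mxE.
  exact: mx_entry_le.
have clA : closed A.
  apply: (@preimage_closed 'rV[R]_(d + 1) ('rV[R]_d * R^o)%type h (epigraph f));
    last exact: f_closed.
  move=> v _.
  apply: (@cvg_pair _ _ _ _ (nbhs (lsubmx v)) (nbhs (rsubmx v 0 0 : R^o))
    (nbhs_filter v) (nbhs_filter _) (nbhs_filter _)) => /=; last first.
    rewrite mxE; under eq_fun do rewrite mxE.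
    exact: (@coord_continuous R 1 (d + 1) 0 (rshift d 0) v).
  exact: lc.
have cvA : @convex_set R 'rV[R]_(d + 1) A.
  apply/convex_setP => u w t t0 t1 Au Aw; rewrite /A /=.
  have -> : h (t *: u + (1 - t) *: w) = t *: h u + (1 - t) *: h w.
    by congr (_, _); rewrite ?linearD ?linearZ//= !mxE.
  by move/convex_setP : f_convex; apply.
have [x0 [r0 fx0]] := proper_finite.
have A0 : A (row_mx x0 r0%:M) by rewrite /A /= hE /epigraph /= fx0.
have [||l [e [e0 le]]] := strict_separation (q := row_mx x r%:M) cvA clA.
- by exists (row_mx x0 r0%:M).
- by rewrite /A /= hE /epigraph /= => /(lt_le_trans rfx); rewrite ltxx.
have {}le x' r' : (f x' <= r'%:E)%E ->
    dot (lsubmx l) x + rsubmx l 0 0 * r + e <= dot (lsubmx l) x' + rsubmx l 0 0 * r'.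
  by move=> fx'; rewrite -!dot_row_scalar_mx; apply: le; rewrite /A /= hE.
exists (lsubmx l), (rsubmx l 0 0), e; split => //.
move: (rsubmx l 0 0) (lsubmx l) le => t y le.
rewrite leNgt; apply/negP => t0.
set K := dot y x + t * r + e - dot y x0 in le *.
(* If [t < 0], raising the ordinate above [x0] by this amount violates the separation. *)
have : (f x0 <= (r0 + (1 + `|t * r0 - (dot y x + t * r + e - dot y x0)|) / - t)%:E)%E.
  by rewrite fx0 lee_fin lerDl divr_ge0 ?oppr_ge0 ?(ltW t0)// addr_ge0.
move=> /le; rewrite mulrDr invrN mulrN mulrN mulrCA divff ?lt_eqF// mulr1.
have := ler_norm (t * r0 - (dot y x + t * r + e - dot y x0)); lra.
Qed.

(* A separation by a non-vertical hyperplane [t > 0] is the graph of the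
   affine function [fun x' => (dot y x + t * r + e - dot y x') / t]. *)
Lemma separation_minorant x r y t e : 0 < e -> 0 < t ->
  (forall x' r', (f x' <= r'%:E)%E ->
    dot y x + t * r + e <= dot y x' + t * r') ->
  exists z s, (forall x' r', (f x' <= r'%:E)%E -> dot z x' - s <= r') /\
    r < dot z x - s.
Proof.
move=> e0 t0 le; exists (- t^-1 *: y), (- (dot y x + t * r + e) / t).
have tn0 : t != 0 by rewrite gt_eqF.
have E x' : t * (dot (- t^-1 *: y) x' - - (dot y x + t * r + e) / t) =
    dot y x + t * r + e - dot y x' by rewrite dotZl; field.
split=> [x' r' /le le'|]; first by rewrite -(ler_pM2l t0) E; lra.
by rewrite -(ltr_pM2l t0) E; lra.
Qed.

(** A vertical hyperplane separates [x] from the domain of [f]. Adding a large multiple of it to any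
    affine minorant lifts the minorant above [r] at [x] while keeping it below [f]. *)
Lemma fenchel_moreau x r : (r%:E < f x)%E ->
  exists y s, (forall x' r', (f x' <= r'%:E)%E -> dot y x' - s <= r') /\
    r < dot y x - s.
Proof.
move=> rfx.
have [x0 [r0 fx0]] := proper_finite.
have [y [t [e [e0 t0 le]]]] := epigraph_separation rfx.
have [t_gt0|] := boolP (0 < t); first exact: separation_minorant le.
rewrite -leNgt => t_le0.
have {t0 t_le0}t0 : t = 0 by apply/le_anti/andP.
(* Below a point where [f] is finite the hyperplane cannot be vertical, so some affine minorant
   exists. *)
have [|y' [t' [e' [e'0 t'0 le']]]] := @epigraph_separation x0 (r0 - 1).
  by rewrite fx0 lte_fin ltrBlDr ltrDl.
have {}t'0 : 0 < t'.
  by have := le' x0 r0; rewrite fx0 lexx => /(_ isT); lra.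
have [y0 [s0 [min0 _]]] := separation_minorant e'0 t'0 le'.
(* [K * e] exceeds the shortfall [r - (dot y0 x - s0)] of the minorant at [x]. *)
pose K := (1 + `|r - dot y0 x + s0|) / e.
have K0 : 0 <= K by rewrite divr_ge0 ?(ltW e0)// addr_ge0.
exists (y0 - K *: y), (s0 - K * (dot y x + e)); split=> [x' r' fx'|].
  rewrite dotDl dotNl dotZl; have := min0 _ _ fx'; have := le _ _ fx'.
  rewrite t0 !mul0r !addr0; nra.
rewrite dotDl dotNl dotZl; have Ke : K * e = 1 + `|r - dot y0 x + s0|.
  by rewrite /K divfK// gt_eqF.
have := ler_norm (r - dot y0 x + s0); nra.
Qed.

(** For [b > 0] this rescales [conjugate_le]. For [b = 0] the perspective is the support function of
    the domain of the biconjugate, which is the domain of [f]. *)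
Lemma perspective_conjugate_le z b s : 0 <= b ->
  (perspective (conjugate f) z b <= s%:E)%E <->
  forall x r, (f x <= r%:E)%E -> dot z x - s <= b * r.
Proof.
move=> b0; rewrite /perspective; have [bp|] := ltP 0 b.
  rewrite -lee_pdivlMl// -EFinM conjugate_le; by split=> h x r /h;
    rewrite dotZl -mulrBr ler_pdivrMl.
move=> bn; have -> : b = 0 by apply/le_anti/andP.
rewrite eqxx; split=> [h x r fx|h].
  have : ((dot x z)%:E <= s%:E)%E.
    apply: le_trans h; apply: ereal_sup_ubound; exists x => //.
    apply: (@le_lt_trans _ _ r%:E); last exact: ltry.
    by apply/conjugate_le => y t /conjugate_le/(_ _ _ fx); rewrite dotC; lra.
  by rewrite lee_fin dotC; lra.
apply: ge_ereal_sup => _ [x /= fx <-].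
suff [r fxr] : exists r, (f x <= r%:E)%E.
  by have := h _ _ fxr; rewrite lee_fin dotC; lra.
case E : (f x) => [r| |]; [by exists r| |by exists 0; rewrite leNye].
have [t ft] : exists t, (conjugate (conjugate f) x <= t%:E)%E.
  move: fx; rewrite /dom /=; case: (conjugate _ _) => [t| |]// _; first by exists t.
  by exists 0; rewrite leNye.
(* If [f x = +oo], some affine minorant exceeds at [x] the bound [t] on the biconjugate. *)
have [|y [s' [/conjugate_le min]]] := @fenchel_moreau x t; first by rewrite E ltry.
by move/conjugate_le : ft => /(_ _ _ min); rewrite dotC; lra.
Qed.

Lemma perspective_conjugate_gtNy z b : (-oo < perspective (conjugate f) z b)%E.
Proof.
have [b0|b0] := leP 0 b; last first.
  by rewrite /perspective (lt_gtF b0) (lt_eqF b0).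
have [x [r fx]] := proper_finite; rewrite ltNye; apply/eqP => pN.
have : (perspective (conjugate f) z b <= (dot z x - b * r - 1)%:E)%E by rewrite pN leNye.
move=> /(perspective_conjugate_le _ _ b0)/(_ x r); rewrite fx lexx => /(_ isT); lra.
Qed.

(** No affine minorant of [f] increases along [x], and [f] is the supremum of its affine
    minorants. *)
Lemma perspective_recession x x' t : (perspective f x 0 <= 0)%E -> 0 <= t ->
  (f x' <= 0)%E -> (f (x' + t *: x)%R <= 0)%E.
Proof.
rewrite /perspective ltxx eqxx => fx t0 fx'; rewrite leNgt; apply/negP.
move=> /fenchel_moreau[y [s [min]]]; rewrite dotDr dotZr.
have := min _ _ fx'.
have : ((dot y x)%:E <= 0)%E.
  apply: le_trans fx; apply: ereal_sup_ubound; exists y => //.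
  by rewrite /dom /= (@le_lt_trans _ _ s%:E) ?ltry//; apply/conjugate_le.
rewrite lee_fin; nra.
Qed.

End proper_closed_convex.
End conjugates.

(** * Lagrange duality for a single maximum of affine functions *)

Section duality.
Set Implicit Arguments.
Unset Strict Implicit.
Local Open Scope ring_scope.
Variable R : realType.

Section max_affine.
Variables (d n : nat) (a : 'I_n -> 'rV[R]_d) (b : 'I_n -> R).

Lemma max_affine_ge j x : ((dot (a j) x + b j)%:E <= max_affine a b x)%E.
Proof. exact: le_bigmax. Qed.

Lemma max_affine_attained x : (0 < n)%N ->
  exists j, max_affine a b x = (dot (a j) x + b j)%:E.
Proof.
move=> n0.
have [|j _ E] := @eq_bigmax _ _ _ -oo%E (Ordinal n0) predT
  (fun j => (dot (a j) x + b j)%:E) isT; first by move=> j _; exact: leNye.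
by exists j.
Qed.

End max_affine.

Section certificates.
Variables (d p : nat) (g : 'rV[R]_d -> \bar R) (c : 'I_p -> 'rV[R]_d -> \bar R).
Hypotheses (c_proper : forall k, proper_fun (c k))
  (c_closed : forall k, closed_fun (c k))
  (c_convex : forall k, convex_fun (c k)).

(* Witnesses that the constraint function of the upper problem is at most
   [s + \sum_k r k] at (y, z, beta); the hypotheses [f x <= t%:E] range over
   epigraphs, which avoids [0 * +oo] when [beta k = 0]. *)
Definition certificate (y : 'rV[R]_d) (s : R) (z : 'I_p -> 'rV[R]_d)
    (beta r : 'I_p -> R) : Prop :=
  (forall x t, (g x <= t%:E)%E -> dot y x - s <= t) /\
  forall k, 0 <= beta k /\
    forall x t, (c k x <= t%:E)%E -> dot (z k) x - r k <= beta k * t.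

Lemma certificate_le y s z beta r : certificate y s z beta r ->
  (conjugate g y + \sum_(k < p) perspective (conjugate (c k)) (z k) (beta k)
    <= (s + \sum_(k < p) r k)%:E)%E.
Proof.
move=> [gys cz]; rewrite EFinD -sumEFin; apply: leeD.
  exact/conjugate_le.
apply: lee_sum => k _; have [bk czk] := cz k.
exact/perspective_conjugate_le.
Qed.

(** No term is [-oo], so a sum below [+oo] has only real terms, and these are the witnesses. A
    negative [beta k] would make its perspective [+oo]. *)
Lemma lty_certificate y z beta : proper_fun g ->
  (conjugate g y + \sum_(k < p) perspective (conjugate (c k)) (z k) (beta k)
    < +oo)%E -> exists s r, certificate y s z beta r /\
  (s + \sum_k r k)%:E = (conjugate g y +
    \sum_(k < p) perspective (conjugate (c k)) (z k) (beta k))%E.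
Proof.
move=> g_proper; set S := (\sum_(k < p) _)%E => yS.
have Ny := conjugate_gtNy g_proper y.
have Nz k : (-oo < perspective (conjugate (c k)) (z k) (beta k))%E.
  exact: perspective_conjugate_gtNy.
have NS : (-oo < S)%E.
  rewrite ltNye; apply/eqP => /esum_eqNyP[k [_ _ kN]].
  by have := Nz k; rewrite kN.
have yy : (conjugate g y < +oo)%E.
  by move: yS Ny NS; case: (conjugate g y) => //; case: S.
have Sy : (S < +oo)%E.
  by move: yS Ny NS; case: (conjugate g y) => //; case: S.
have zy k : (perspective (conjugate (c k)) (z k) (beta k) < +oo)%E.
  rewrite ltey; apply/eqP => ky; move: Sy; rewrite ltey => /eqP; apply.
  apply/esum_eqyP; first by move=> l _; rewrite gt_eqF.
  by exists k; rewrite mem_index_enum.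
exists (fine (conjugate g y)), (fun k => fine (perspective (conjugate (c k)) (z k) (beta k))).
have fy : (conjugate g y <= (fine (conjugate g y))%:E)%E.
  by rewrite fineK// fin_real// Ny.
have fz k : (perspective (conjugate (c k)) (z k) (beta k) <=
    (fine (perspective (conjugate (c k)) (z k) (beta k)))%:E)%E.
  by rewrite fineK// fin_real// Nz zy.
split; last first.
  rewrite EFinD -sumEFin fineK ?fin_real ?Ny//; congr (_ + _)%E.
  by apply: eq_bigr => k _; rewrite fineK// fin_real// Nz zy.
split=> [|k]; first exact/conjugate_le.
have bk : 0 <= beta k.
  rewrite leNgt; apply/negP => bk; have := zy k.
  by rewrite /perspective (lt_gtF bk) (lt_eqF bk).
by split=> //; apply/perspective_conjugate_le.
Qed.

End certificates.

Lemma sum_delta (V : nmodType) p (k : 'I_p) (v : V) :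
  \sum_(l < p) (if l == k then v else 0) = v.
Proof. by rewrite -big_mkcond big_pred1_eq. Qed.

Section single_piece.
Variables (d n p : nat) (a : 'I_n -> 'rV[R]_d) (b : 'I_n -> R)
  (c : 'I_p -> 'rV[R]_d -> \bar R).
Hypotheses (n_gt0 : (0 < n)%N) (c_proper : forall k, proper_fun (c k))
  (c_closed : forall k, closed_fun (c k))
  (c_convex : forall k, convex_fun (c k)).
Let g := max_affine a b.
Let cert := certificate g c.

Lemma max_affine_proper : proper_fun g.
Proof.
have gE x : exists r, g x = r%:E.
  by have [j E] := max_affine_attained a b x n_gt0; eexists; exact: E.
split=> [x|]; first by have [r ->] := gE x.
by exists 0; have [r ->] := gE 0.
Qed.

(** A large weight [N] on a minorant of [c k] will force the point found by separation to satisfy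
    [c k x <= 0]. *)
Let piece_certificate j k z s N : 0 <= N ->
  (forall x t, (c k x <= t%:E)%E -> dot z x - s <= t) ->
  cert (a j) (- b j) (fun l => if l == k then N *: z else 0)
    (fun l => if l == k then N else 0) (fun l => if l == k then N * s else 0).
Proof.
move=> N0 cz; split=> [x t|l].
  have := max_affine_ge a b j x; rewrite -/(g x) => /le_trans/[apply].
  by rewrite lee_fin opprK.
have [->|_] := eqVneq; last first.
  by split=> // x t _; rewrite dot0l mul0r subr0.
split=> // x t /cz h; rewrite dotZl -mulrBr; exact: ler_wpM2l.
Qed.

Let base_certificate j : cert (a j) (- b j) (fun=> 0) (fun=> 0) (fun=> 0).
Proof.
split=> [x t|k].
  have := max_affine_ge a b j x; rewrite -/(g x) => /le_trans/[apply].
  by rewrite lee_fin opprK.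
by split=> // x t _; rewrite dot0l mul0r subr0.
Qed.

(* [balanced] is the trace of the Slater point: 0 lies in the relative interior
   of the convex set of all sums [y + \sum_k z k]. *)
Lemma certificate_exists v :
  (forall y s z beta r, cert y s z beta r -> exists2 e, 0 < e &
    exists y' s' z' beta' r', cert y' s' z' beta' r' /\
      y' + \sum_k z' k = - e *: (y + \sum_k z k)) ->
  (forall x, sublevel c x -> (v%:E < g x)%E) ->
  exists y s z beta r, [/\ cert y s z beta r, y + \sum_k z k = 0 &
    s + \sum_k r k = - v].
Proof.
move=> balanced vg.
(* The shift by [v] moves the pair [(0, - v)] to be reached to the origin. *)
pose C := [set u : 'rV[R]_(d + 1) | exists y s z beta r, cert y s z beta r /\
  u = row_mx (y + \sum_k z k) (s + \sum_k r k + v)%:M].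
apply: contrapT => nex.
have nC0 : ~ C 0.
  move=> [y [s [z [beta [r [h]]]]]]; rewrite -row_mx0 => /eq_row_mx[w0 t0].
  apply: nex; exists y, s, z, beta, r; split => //.
  by move: t0 => /matrixP/(_ 0 0); rewrite !mxE eqxx mulr1n; lra.
have cvC : @convex_set R 'rV[R]_(d + 1) C.
  apply/convex_setP => _ _ t t0 t1
    [y [s [z [beta [r [[h1 h2] ->]]]]]] [y' [s' [z' [beta' [r' [[h1' h2'] ->]]]]]].
  exists (t *: y + (1 - t) *: y'), (t * s + (1 - t) * s'),
    (fun k => t *: z k + (1 - t) *: z' k),
    (fun k => t * beta k + (1 - t) * beta' k),
    (fun k => t * r k + (1 - t) * r' k); split.
    split=> [x u gu|k].
      rewrite dotDl !dotZl; have := h1 _ _ gu; have := h1' _ _ gu; nra.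
    have [bk hk] := h2 k; have [bk' hk'] := h2' k; split.
      by rewrite addr_ge0// mulr_ge0// subr_ge0.
    move=> x u cu; rewrite dotDl !dotZl; have := hk _ _ cu; have := hk' _ _ cu; nra.
  rewrite !scale_row_mx add_row_mx !scalerDr !scaler_sumr; congr row_mx.
    by rewrite addrACA -big_split.
  rewrite !scale_scalar_mx -raddfD/=; congr _%:M.
  rewrite big_split/= -!mulr_sumr; ring.
pose j0 := Ordinal n_gt0.
have C0 : C !=set0.
  eexists; exists (a j0), (- b j0), (fun=> 0), (fun=> 0), (fun=> 0).
  by split; [exact: base_certificate|reflexivity].
have [l lC [_ [y1 [s1 [z1 [b1 [r1 [cert1 ->]]]]]] pos]] := proper_separation cvC C0 nC0.
pose xi := lsubmx l; pose t := rsubmx l 0 0.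
have lE w u : dot l (row_mx w u%:M) = dot xi w + t * u.
  exact: dot_row_scalar_mx.
have {}lC y s z beta r : cert y s z beta r ->
    0 <= dot xi (y + \sum_k z k) + t * (s + \sum_k r k + v).
  by move=> h; rewrite -lE; apply: lC; exists y, s, z, beta, r.
rewrite lE in pos.
(* The bound [s] can be enlarged freely, which rules out [t < 0]. *)
have certS y s z beta r u : 0 <= u -> cert y s z beta r -> cert y (s + u) z beta r.
  by move=> u0 [h1 h2]; split=> // x q /h1; lra.
have [t_lt0|t_gt0|t0] := ltgtP t 0.
- set A := dot xi (y1 + \sum_k z1 k) in pos.
  set B := s1 + \sum_k r1 k + v in pos.
  (* This increase of [s] brings the separating form down to -1. *)
  have := lC _ _ _ _ _ (certS _ _ _ _ _ ((A + t * B + 1) / - t) _ cert1).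
  have -> : s1 + (A + t * B + 1) / - t + \sum_k r1 k + v = B + (A + t * B + 1) / - t.
    by rewrite /B; ring.
  rewrite -/A; have -> : t * (B + (A + t * B + 1) / - t) = - A - 1.
    by field; rewrite lt_eqF.
  have h : 0 <= (A + t * B + 1) / - t by rewrite divr_ge0//; lra.
  by move=> /(_ h); lra.
(* Division by [t > 0] turns the form into an upper bound on [dot x (y + \sum_k z k)]; the point [x]
   will contradict [vg]. *)
- pose x := - t^-1 *: xi.
  have tn0 : t != 0 by rewrite gt_eqF.
  have xE w : dot xi w = - t * dot x w by rewrite dotZl; field.
  have {}lC y s z beta r : cert y s z beta r ->
      dot x (y + \sum_k z k) <= s + \sum_k r k + v.
    by move=> /lC; rewrite xE mulNr addrC -mulrBr pmulr_rge0// subr_ge0.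
  have Xx : sublevel c x.
    move=> k; rewrite leNgt; apply/negP.
    move=> /(fenchel_moreau (c_proper k) (@c_closed k) (@c_convex k)).
    move=> [z [s [min zs]]].
    (* [N] times the gap [dot z x - s] exceeds [v - b j0 - dot x (a j0)], the most that [lC]
       allows. *)
    pose N := (1 + `|v - b j0 - dot x (a j0)|) / (dot z x - s).
    have N0 : 0 <= N by rewrite divr_ge0 ?(ltW zs)// addr_ge0.
    have := lC _ _ _ _ _ (piece_certificate j0 N0 min).
    rewrite !sum_delta dotDr dotZr.
    have : N * (dot z x - s) = 1 + `|v - b j0 - dot x (a j0)|.
      by rewrite /N divfK// gt_eqF.
    rewrite (dotC z).
    have := ler_norm (v - b j0 - dot x (a j0)); nra.
  have [j gj] := max_affine_attained a b x n_gt0.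
  have := vg _ Xx; rewrite /g gj lte_fin.
  (* Piece [j] attains the maximum at [x], so its certificate with zero multipliers yields
     [g x <= v]. *)
  have := lC _ _ _ _ _ (base_certificate j).
  by rewrite !big1// !addr0 dotC; lra.
(* The form now ignores the last coordinate. It is positive at the sum in [cert1], while [balanced]
   attains a negative multiple of that sum. *)
- have [e e0 [y' [s' [z' [b' [r' [h E]]]]]]] := balanced _ _ _ _ _ cert1.
  have := lC _ _ _ _ _ h; rewrite E t0 mul0r addr0 dotZr.
  move: pos; rewrite t0 mul0r addr0; nra.
Qed.

End single_piece.
End duality.

(** * The upper problem and its Slater point *)

Section upper_problem.
Set Implicit Arguments.
Unset Strict Implicit.
Local Open Scope ring_scope.
Variable R : realType.

(** The line through [w] and [u] stays in the affine hull, so the relative neighbourhood of [w]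
    catches its points just beyond [w]. *)
Lemma relint_line_extension (E : normedModType R) (D : set E) (w u : E) :
  relint D w -> D u -> exists2 e, 0 < e & D (w - e *: (u - w)).
Proof.
move=> [affw Dw] Du.
have affu : affine_hull D u by apply: sub_gen_smallest.
have aff e : affine_hull D (w - e *: (u - w)).
  have -> : w - e *: (u - w) = (1 - - e) *: w + (- e) *: u.
    by rewrite scalerBr opprB opprK scalerDl scale1r scaleNr addrA.
  move=> B AB; have [affB DB] := AB; by apply: affB; [exact: affw|exact: affu].
have /(_ 0) : continuous (fun e : R => w - e *: (u - w)).
  move=> e; apply: (@cvgB _ _ _ _ (nbhs_filter e)); first exact: cvg_cst.
  by apply: (@cvgZr_tmp _ _ _ _ (nbhs_filter e)); exact: cvg_id.
rewrite /continuous_at scale0r subr0 => /(_ _ Dw).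
move=> /nbhs_ballP[e /= e0 eD]; exists (e / 2); first by rewrite divr_gt0.
apply: eD => //=; rewrite /ball /= sub0r normrN ger0_norm; last by rewrite divr_ge0 ?ltW.
by rewrite ltr_pdivrMr// ltr_pMr// ltr1n.
Qed.

Section upper_vector.
Variables (d m p : nat).

(** Flattening [z] by [mxvec], one coordinate [l] at a time, matches the row indexing in [uz]. *)
Definition mk_upper (al : R) (beta : 'I_m -> 'I_p -> R) (y : 'I_m -> 'rV[R]_d)
    (z : 'I_m -> 'I_p -> 'rV[R]_d) : upper_space R d m p :=
  (al, \matrix_(i, k) beta i k, \matrix_(i, l) y i 0 l,
   \matrix_(q, l) mxvec (\matrix_(i, k) z i k 0 l) 0 q).

Lemma ubeta_mk al beta y z i k : ubeta (mk_upper al beta y z) i k = beta i k.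
Proof. by rewrite /ubeta mxE. Qed.

Lemma uy_mk al beta y z i : uy (mk_upper al beta y z) i = y i.
Proof. by apply/rowP => l; rewrite !mxE. Qed.

Lemma uz_mk al beta y z i k : uz (mk_upper al beta y z) i k = z i k.
Proof. by apply/rowP => l; rewrite 2!mxE mxvecE mxE. Qed.

Lemma uy_line (w u : upper_space R d m p) e i :
  uy (w - e *: (u - w)) i = uy w i - e *: (uy u i - uy w i).
Proof. by apply/rowP => l; rewrite !mxE. Qed.

Lemma uz_line (w u : upper_space R d m p) e i k :
  uz (w - e *: (u - w)) i k = uz w i k - e *: (uz u i k - uz w i k).
Proof. by apply/rowP => l; rewrite !mxE. Qed.

End upper_vector.

Variables (d m n p : nat) (a : 'I_m -> 'I_n -> 'rV[R]_d) (b : 'I_m -> 'I_n -> R)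
  (c : 'I_p -> 'rV[R]_d -> \bar R).
Hypotheses (n_gt0 : (0 < n)%N) (c_proper : forall k, proper_fun (c k))
  (c_closed : forall k, closed_fun (c k))
  (c_convex : forall k, convex_fun (c k)).
Let g i := max_affine (a i) (b i).

(** The balance sum vanishes at the Slater point [w]. Going past [w], away from the given data, by a
    factor [e] multiplies their sum by [- e] and keeps the constraint below [+oo]. *)
Lemma slater_balanced i : upper_slater g c ->
  forall y s z beta r, certificate (g i) c y s z beta r -> exists2 e, 0 < e &
    exists y' s' z' beta' r', certificate (g i) c y' s' z' beta' r' /\
      y' + \sum_k z' k = - e *: (y + \sum_k z k).
Proof.
move=> [w [[_ ri _] [_ weq _]]] y s z beta r h.
have w0 : uy w i + \sum_k uz w i k = 0.
  by apply/rowP => l; have [->] := weq (i, l); rewrite mxE.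
(* Only block [i] enters the constraint [inl i], so every block may carry the same data; any real
   [alpha] stays in the domain. *)
pose u : upper_space R d m p := mk_upper 0 (fun=> beta) (fun=> y) (fun=> z).
have Du : dom (upper_ineq g c (inl i)) u.
  rewrite /dom /= uy_mk; under eq_bigr do rewrite uz_mk ubeta_mk.
  rewrite oppr0 adde0; apply: le_lt_trans (ltry _).
  exact: (certificate_le _ _ _ h).
have [e e0] := relint_line_extension (ri (inl i)) Du.
set v := w - _; rewrite /dom /= => Dv.
have [||s' [r' [h' _]]] := @lty_certificate R d p (g i) c c_proper c_closed c_convex
   (uy v i) (uz v i) (ubeta v i).
- exact: max_affine_proper.
- by move: Dv; case: (conjugate _ _ + _)%E => [q _| //|_]; rewrite ?ltry.
exists e => //; exists (uy v i), s', (uz v i), (ubeta v i), r'.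
split; first exact: h'.
rewrite uy_line; under eq_bigr do rewrite uz_line.
rewrite sumrB -scaler_sumr sumrB.
have -> : \sum_k uz u i k = \sum_k z k by apply: eq_bigr => k _; rewrite uz_mk.
rewrite uy_mk.
rewrite addrACA w0 add0r -opprD -scalerDr addrACA -opprD w0 subr0.
by rewrite scaleNr.
Qed.

(** The constraints share only [alpha], so certificates found for each [i] at the common value [- v]
    assemble into a feasible point. *)
Lemma upper_value_ge v : upper_slater g c ->
  (forall i x, sublevel c x -> (v%:E < g i x)%E) -> (v%:E <= upper_value g c)%E.
Proof.
move=> slater vg.
have /choice[f fP] i : exists q : 'rV[R]_d * R * ('I_p -> 'rV[R]_d) *
    ('I_p -> R) * ('I_p -> R),
  [/\ certificate (g i) c q.1.1.1.1 q.1.1.1.2 q.1.1.2 q.1.2 q.2,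
    q.1.1.1.1 + \sum_k q.1.1.2 k = 0 & q.1.1.1.2 + \sum_k q.2 k = - v].
  have [y [s [z [beta [r h]]]]] := certificate_exists n_gt0 c_proper c_closed c_convex
    (@slater_balanced i slater) (vg i).
  by exists (y, s, z, beta, r).
pose w : upper_space R d m p := mk_upper (- v) (fun i => (f i).1.2) (fun i => (f i).1.1.1.1)
  (fun i => (f i).1.1.2).
apply: ereal_sup_ubound; exists w; last by rewrite /ualpha /= opprK.
split=> [i|i|i k].
- have [h _ E] := fP i; rewrite uy_mk; under eq_bigr do rewrite uz_mk ubeta_mk.
  by rewrite /ualpha /= -E; exact: certificate_le.
- by have [_ E _] := fP i; rewrite uy_mk; under eq_bigr do rewrite uz_mk.
- by have [[_ /(_ k)[]]] := fP i; rewrite ubeta_mk.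
Qed.

(** Weak duality: in the sum of the Fenchel-Young inequalities at [x], the balance equation cancels
    the linear terms. *)
Lemma upper_feasible_le w i x : upper_feasible g c w -> sublevel c x ->
  ((- ualpha w)%:E <= g i x)%E.
Proof.
move=> [/(_ i) wi /(_ i) weq wbeta] Xx.
have [s [r [h E]]] := lty_certificate c_proper c_closed c_convex
  (max_affine_proper (a i) (b i) n_gt0) (le_lt_trans wi (ltry _)).
have {wi} : s + \sum_k r k <= ualpha w by rewrite -lee_fin E.
case: h => [gys h]; rewrite /g.
have [j gj] := max_affine_attained (a i) (b i) x n_gt0.
rewrite gj lee_fin; set t := dot _ _ + _ in gj *.
have : (max_affine (a i) (b i) x <= t%:E)%E by rewrite gj.
move=> /gys.
have : \sum_k dot (uz w i k) x <= \sum_k r k.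
  (* Since [c k x <= 0], the ordinate [0] is admissible and the term in [beta] disappears. *)
  apply: ler_sum => k _; have [_ /(_ x 0 (Xx k))] := h k; rewrite mulr0; lra.
under eq_bigr do rewrite dotC; rewrite -dot_sumr.
have -> : \sum_k uz w i k = - uy w i by apply/eqP; rewrite -addr_eq0 addrC weq.
rewrite dotNr (dotC x); lra.
Qed.

End upper_problem.

(** * Integration against finitely supported measures *)

Section discrete_measure.
Set Implicit Arguments.
Unset Strict Implicit.
Variables (disp : measure_display) (T : measurableType disp) (R : realType)
  (I : eqType) (w : I -> {nonneg R}) (pt : I -> T).

(** Recursion on a list lets integrals be computed by induction and zero weights be removed by
    filtering. *)
Definition discrete_measure (r : seq I) : {measure set T -> \bar R} :=
  foldr (fun i (mu : {measure set T -> \bar R}) =>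
    measure_add (mscale (w i) (dirac (pt i))) mu : {measure set T -> \bar R})
  mzero r.

Lemma discrete_measureE r A :
  discrete_measure r A = \sum_(i <- r) (w i)%:num%:E * \d_(pt i) A.
Proof.
elim: r => [|i r IH]; first by rewrite big_nil.
by rewrite big_cons -IH; exact: measure_addE.
Qed.

Lemma ge0_integral_discrete (r : seq I) (D : set T) (h : T -> \bar R) : measurable D ->
  measurable_fun D h -> (forall x, D x -> 0 <= h x) ->
  (forall i, i \in r -> D (pt i)) ->
  \int[discrete_measure r]_(x in D) h x = \sum_(i <- r) (w i)%:num%:E * h (pt i).
Proof.
move=> mD mh h0; elim: r => [|i r IH] Dr.
  by rewrite big_nil integral_measure_zero.
rewrite big_cons /= ge0_integral_measure_add// IH; last first.
  by move=> j jr; apply: Dr; rewrite inE jr orbT.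
congr (_ + _); rewrite ge0_integral_mscale// integral_dirac//.
by rewrite diracE mem_set ?mul1e//; apply: Dr; rewrite mem_head.
Qed.

Lemma integral_discrete (r : seq I) (D : set T) (f : T -> R) : measurable D ->
  measurable_fun D f -> (forall i, i \in r -> D (pt i)) ->
  \int[discrete_measure r]_(x in D) (f x)%:E =
    (\sum_(i <- r) (w i)%:num * f (pt i))%R%:E.
Proof.
move=> mD mf Dr; have mEf : measurable_fun D (EFin \o f) by exact/measurable_EFinP.
rewrite integralE !ge0_integral_discrete//.
- rewrite -sumEFin.
  transitivity (\sum_(i <- r) ((w i)%:num * Num.max (f (pt i)) 0)%R%:E -
      \sum_(i <- r) ((w i)%:num * Num.max (- f (pt i)) 0)%R%:E).
    congr (_ - _); apply: eq_bigr => i _.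
      by rewrite funeposE /= EFinM EFin_max.
    by rewrite funenegE /= EFinM EFin_max EFinN.
  rewrite !sumEFin -EFinB -sumrB; congr (_%:E); apply: eq_bigr => i _.
  rewrite -mulrBr; congr (_ * _)%R.
  by rewrite /Num.max; case: ltP => ?; case: ltP => ?; lra.
- exact: measurable_funeneg.
- exact: measurable_funepos.
Qed.

Lemma discrete_measureT (r : seq I) : (\sum_(i <- r) (w i)%:num = 1)%R ->
  discrete_measure r setT = 1.
Proof.
move=> w1; rewrite discrete_measureE.
under eq_bigr do rewrite diracT mule1.
by rewrite sumEFin w1.
Qed.

End discrete_measure.

(** * Measures of total mass 1 as probabilities *)

Section probability_of_measure.
Variables (disp : measure_display) (T : measurableType disp) (R : realType)
  (mu : {measure set T -> \bar R}) (mu1 : mu setT = 1).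

Let muT : set T -> \bar R := mu.

HB.instance Definition _ := Measure.on muT.

HB.instance Definition _ :=
  Measure_isProbability.Build _ _ _ muT mu1.

Definition probability_of_measure : probability T R := muT.

End probability_of_measure.

(** * The moment problem and the lower problem *)

Section moment_problem.
Set Implicit Arguments.
Unset Strict Implicit.
Variables (R : realType) (d : nat).

Lemma closed_borel (A : set 'rV[R]_d) :
  closed A -> measurable (A : set (borel_space R d)).
Proof.
move=> clA; rewrite -(setCK A); apply: measurableC.
by apply: sub_sigma_algebra; exact: closed_openC.
Qed.

Lemma continuous_borel (f : 'rV[R]_d -> R) : continuous f ->
  measurable_fun setT (f : borel_space R d -> R).
Proof.
move=> /continuousP cf.
apply: (measurability _ (RGenOpens.measurableE R)) => _ [_ [x [y ->] <-]].
by rewrite setTI; apply: sub_sigma_algebra; apply: cf; exact: interval_open.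
Qed.

Lemma affine_continuous (a : 'rV[R]_d) (b : R) :
  continuous (fun x => dot a x + b)%R.
Proof.
by move=> x; apply: continuousD; [exact: dot_continuous|exact: cst_continuous].
Qed.

Variables (m n p : nat) (a : 'I_m -> 'I_n -> 'rV[R]_d) (b : 'I_m -> 'I_n -> R)
  (c : 'I_p -> 'rV[R]_d -> \bar R).
Hypotheses (m_gt0 : (0 < m)%N) (n_gt0 : (0 < n)%N)
  (c_proper : forall k, proper_fun (c k))
  (c_closed : forall k, closed_fun (c k))
  (c_convex : forall k, convex_fun (c k)).
Let gi i := max_affine (a i) (b i).
Let g := min_fun gi.
Let X := sublevel c.

(** Each set [c k x <= 0] is the slice at height [0] of a closed epigraph. *)
Lemma sublevel_closed : closed X.
Proof.
have -> : X = \bigcap_k [set x | c k x <= 0].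
  by apply/seteqP; split => x Xx k; [move=> _; exact: Xx|exact: Xx k I].
apply: closed_bigI => k _.
apply: (@preimage_closed 'rV[R]_d ('rV[R]_d * R^o)%type (fun x => (x, 0%R : R^o))
  (epigraph (c k))); last exact: c_closed.
move=> x _; apply: (@cvg_pair _ _ _ _ (nbhs x) (nbhs (0%R : R^o))
  (nbhs_filter x) (nbhs_filter _) (nbhs_filter _)); first exact: cvg_id.
exact: cvg_cst.
Qed.

Lemma min_fun_le i x : g x <= gi i x.
Proof. exact: bigmin_le. Qed.

Lemma min_fun_attained x : exists i j, g x = (dot (a i j) x + b i j)%R%:E.
Proof.
have [|i _ E] := @eq_bigmin _ _ _ +oo (Ordinal m_gt0) predT
  (fun i => gi i x) isT; first by move=> i _; exact: leey.
have [j gj] := max_affine_attained (a i) (b i) x n_gt0.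
by exists i, j; rewrite -gj -/(gi i x) -E.
Qed.

Lemma min_fun_fine x : g x = (fine (g x))%:E.
Proof. by have [i [j ->]] := min_fun_attained x. Qed.

Lemma min_fun_measurable : measurable_fun setT (fine \o g : borel_space R d -> R).
Proof.
apply/measurable_EFinP.
rewrite (_ : EFin \o _ = g); last by apply/funext => x; rewrite /= -min_fun_fine.
rewrite /g /min_fun; elim: (index_enum _) => [|i r IH].
  by under eq_fun do rewrite big_nil; exact: measurable_cst.
under eq_fun do rewrite big_cons; apply: measurable_mine => //.
rewrite /gi /max_affine; elim: (index_enum _) => [|j s IHj].
  by under eq_fun do rewrite big_nil; exact: measurable_cst.
under eq_fun do rewrite big_cons; apply: measurable_maxe => //.
apply/measurable_EFinP; apply: continuous_borel; exact: affine_continuous.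
Qed.

Hypothesis X_bounded : bounded_set X.

(** Supplies the integrability of [g] under any probability carried by [X]. *)
Lemma min_fun_bounded : [bounded fine (g x) | x in X].
Proof.
have [M [_ XM]] := X_bounded.
have {}XM x : X x -> (`|x| <= `|M| + 1)%R.
  by apply: XM; rewrite (le_lt_trans (ler_norm M))// ltrDl.
set N := (`|M| + 1)%R in XM.
have N0 : (0 <= N)%R by rewrite addr_ge0.
pose B := (\sum_i \sum_j (`|b i j| + \sum_l (`|a i j 0 l| * N)))%R.
exists B; split; first exact: num_real.
move=> K /ltW BK x Xx /=; apply: le_trans BK.
have [i [j ->]] := min_fun_attained x; rewrite /= addrC.
have term0 i' j' : (0 <= `|b i' j'| + \sum_l (`|a i' j' 0 l| * N))%R.
  by rewrite addr_ge0// sumr_ge0// => l _; rewrite mulr_ge0.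
apply: (le_trans (ler_normD _ _)).
apply: (@le_trans _ _ (`|b i j| + \sum_l (`|a i j 0 l| * N))%R).
  rewrite lerD2l; apply: (le_trans (ler_norm_sum _ _ _)).
  apply: ler_sum => l _; rewrite normrM; apply: ler_wpM2l => //.
  by apply: le_trans (XM _ Xx); exact: mx_entry_le.
rewrite /B (bigD1 i)//= (bigD1 j)//= -addrA lerDl addr_ge0//.
  by rewrite sumr_ge0.
by rewrite sumr_ge0// => i' _; rewrite sumr_ge0.
Qed.

Lemma moment_lower_bound (mu : probability (borel_space R d) R) (v : R) :
  mu X = 1 -> (forall x, X x -> v%:E <= g x) -> v%:E <= \int[mu]_(x in X) g x.
Proof.
move=> muX vg; have mX := closed_borel sublevel_closed.
rewrite -[leLHS]mule1 -muX -integral_cst//.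
have -> : \int[mu]_(x in X) g x = \int[mu]_(x in X) (fine (g x))%:E.
  by apply: eq_integral => x _; rewrite -min_fun_fine.
apply: le_integral => //.
- by apply: (finite_measure_integrable_cst mu v mX).
- apply: measurable_bounded_integrable => //; first by rewrite muX ltry.
    exact: measurable_funS min_fun_measurable.
  exact: min_fun_bounded.
by move=> x /set_mem Xx /=; rewrite -min_fun_fine; exact: vg.
Qed.

(** All the mass goes to index [i] at [x]. The other indices receive [(0, 0)], where a perspective
    is a supremum of zeros, or [-oo]. *)
Lemma lower_value_le i x : X x -> lower_value gi c <= gi i x.
Proof.
move=> Xx; have [j gj] := max_affine_attained (a i) (b i) x n_gt0.
pose delta (V : zmodType) (v : V) l := if l == i then v else 0%R.
have p0 (f : 'rV[R]_d -> \bar R) : perspective f 0 0 <= 0.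
  rewrite /perspective ltxx eqxx; apply: ge_ereal_sup => _ [y _ <-].
  by rewrite dot0r.
have p1 (f : 'rV[R]_d -> \bar R) y : perspective f y 1 = f y.
  by rewrite /perspective ltr01 invr1 scale1r mul1e.
apply: ereal_inf_lbound; exists (delta R (fine (gi i x))), (delta R 1%R), (delta _ x).
split; last by rewrite sum_delta /gi gj.
split=> [l k|l||l].
- by rewrite /delta; case: eqVneq => // _; rewrite p1; exact: Xx.
- by rewrite /delta; case: eqVneq => [->|//]; rewrite p1 /gi gj.
- exact: sum_delta.
- by rewrite /delta; case: eqVneq.
Qed.

(** The ray from [x0] along [x] stays in the bounded set [X]. *)
Lemma recession_eq0 x x0 : X x0 -> (forall k, perspective (c k) x 0 <= 0) -> x = 0%R.
Proof.
move=> Xx0 rec; have [M [_ XM]] := X_bounded.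
have Xt t : (0 <= t)%R -> X (x0 + t *: x)%R.
  move=> t0 k.
  by apply: (perspective_recession (c_proper k) (@c_closed k) (@c_convex k)).
apply/eqP; rewrite -normr_eq0; apply/eqP/le_anti; rewrite normr_ge0 andbT leNgt.
(* With this [t], the norm of [x0 + t *: x] is at least [|M| + 2], whereas [X] has norms at most
   [|M| + 1]. *)
apply/negP => x_gt0; pose t := ((`|M| + 1 + `|x0| + 1) / `|x|)%R.
have t0 : (0 <= t)%R by rewrite divr_ge0// !addr_ge0.
have /XM : (M < `|M| + 1)%R by rewrite (le_lt_trans (ler_norm M))// ltrDl.
move=> /(_ _ (Xt t t0)) /=; have := ler_normB (x0 + t *: x)%R x0.
rewrite addrC addKr normrZ (ger0_norm t0) /t divfK ?gt_eqF//; lra.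
Qed.

Section feasible.
Variables (eta lam : 'I_m -> R) (x : 'I_m -> 'rV[R]_d).
Hypothesis feas : lower_feasible gi c eta lam x.

Let lam_ge0 i : (0 <= lam i)%R.
Proof. by case: feas. Qed.

Lemma feasible_point i : lam i != 0%R -> X ((lam i)^-1 *: x i)%R.
Proof.
move=> li0 k; have [/(_ i k) + _ _ _] := feas.
have li : (0 < lam i)%R by rewrite lt_def li0 lam_ge0.
by rewrite /perspective li pmule_rle0// lte_fin.
Qed.

Lemma feasible_cost :
  (\sum_(i < m | lam i != 0) lam i * fine (g ((lam i)^-1 *: x i)) <= \sum_i eta i)%R.
Proof.
have [pc pg lam1 _] := feas.
have [i0 li0] : exists i, lam i != 0%R.
  apply: contrapT => nex; have : (\sum_i lam i = 0)%R.
    by apply: big1 => i _; apply/eqP; apply: contrapT => /negP li; apply: nex; exists i.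
  by rewrite lam1 => /eqP; rewrite oner_eq0.
rewrite big_mkcond; apply: ler_sum => i _; rewrite -lee_fin; apply: le_trans (pg i).
have [li|li] := eqVneq (lam i) 0%R.
  have xi : x i = 0%R.
    by apply: (recession_eq0 (feasible_point li0)) => k; rewrite -{1}li.
  (* As [x i = 0], this is a supremum of zeros over a domain containing a slope of [gi i]; hence
     [eta i >= 0]. *)
  rewrite li /perspective ltxx eqxx; apply: ereal_sup_ubound.
  exists (a i (Ordinal n_gt0)); last by rewrite xi dot0r.
  rewrite /dom /=; apply: (@le_lt_trans _ _ (- b i (Ordinal n_gt0))%R%:E); last exact: ltry.
  apply/conjugate_le => y t.
  have := max_affine_ge (a i) (b i) (Ordinal n_gt0) y.
  by move=> /le_trans/[apply]; rewrite lee_fin opprK.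
have lip : (0 < lam i)%R by rewrite lt_def li lam_ge0.
rewrite /perspective lip EFinM lee_pmul2l// -min_fun_fine.
exact: min_fun_le.
Qed.

Lemma feasible_measure : exists2 mu : probability (borel_space R d) R,
  (forall A : set (borel_space R d), measurable A ->
    mu A = \sum_(i < m | lam i != 0%R)
      (lam i)%:E * \d_((((lam i)^-1 *: x i)%R : borel_space R d)) A) &
  mu X = 1 /\ \int[mu]_(y in X) g y <= (\sum_(i < m) eta i)%R%:E.
Proof.
have [_ _ lam1 _] := feas.
pose w i : {nonneg R} := NngNum (lam_ge0 i).
pose pt i : borel_space R d := ((lam i)^-1 *: x i)%R.
(* Filtering leaves only atoms in [X], as [integral_discrete] demands. *)
pose r := [seq i <- index_enum 'I_m | lam i != 0%R].
have w1 : (\sum_(i <- r) (w i)%:num = 1)%R.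
  rewrite big_filter -[RHS]lam1 [RHS](bigID (fun i => lam i == 0%R))/=.
  by rewrite [X in _ = (X + _)%R]big1 ?add0r// => i /eqP.
pose mu := probability_of_measure (discrete_measureT pt w1).
have muE A : mu A = \sum_(i < m | lam i != 0%R) (lam i)%:E * \d_(pt i) A.
  by rewrite /= discrete_measureE big_filter.
have Xr i : i \in r -> X (pt i).
  by rewrite mem_filter => /andP[/feasible_point].
exists mu => [A _|]; first exact: muE.
split.
  rewrite muE -w1 -sumEFin big_filter; apply: eq_bigr => i li.
  by rewrite diracE mem_set ?mule1//; exact: feasible_point.
have -> : \int[mu]_(y in X) g y = \int[mu]_(y in X) (fine (g y))%:E.
  by apply: eq_integral => y _; rewrite -min_fun_fine.
rewrite integral_discrete//.
- by rewrite lee_fin big_filter; exact: feasible_cost.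
- exact: closed_borel sublevel_closed.
- exact: measurable_funS min_fun_measurable.
Qed.

End feasible.
End moment_problem.

(** * Comparison of the three values and optimality of the discrete measure *)

(** Bridges the strict inequality that [upper_value_ge] requires on [X]. *)
Lemma lee_lt_real (R : realType) (x y : \bar R) :
  (forall v : R, v%:E < x -> v%:E <= y) -> x <= y.
Proof.
case: x y => [x| |] [y| |] h //; rewrite ?leey ?leNye//.
- rewrite lee_fin; apply/ler_addgt0Pr => e e0.
  have := h (x - e)%R; rewrite lte_fin lee_fin => h'; lra.
- by have := h (x - 1)%R; rewrite lte_fin ltrBlDr ltrDl ltr01 leeNy_eq => /(_ isT).
- by have := h (y + 1)%R (ltry _); rewrite lee_fin gerDl ler10.
- by have := h 0%R (ltry _).
Qed.

Theorem theorem2 (R : realType) (d m n p : nat)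
    (m_gt0 : (0 < m)%N) (n_gt0 : (0 < n)%N) (p_gt0 : (0 < p)%N)
    (a : 'I_m -> 'I_n -> 'rV[R]_d) (b : 'I_m -> 'I_n -> R)
    (c : 'I_p -> 'rV[R]_d -> \bar R)
    (c_proper : forall k, proper_fun (c k))
    (c_closed : forall k, closed_fun (c k))
    (c_convex : forall k, convex_fun (c k)) :
  let gi := fun i : 'I_m => max_affine (a i) (b i) in
  let g := min_fun gi in
  let X := sublevel c in
  bounded_set X ->
  upper_slater gi c ->
  [/\ lower_value gi c = moment_value X g,
      moment_value X g = upper_value gi c &
      forall (eta lam : 'I_m -> R) (x : 'I_m -> 'rV[R]_d),
        lower_solution gi c eta lam x ->
        exists2 mu : probability (borel_space R d) R,
          (forall A : set (borel_space R d), measurable A ->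
             mu A = \sum_(i < m | lam i != 0%R)
                      (lam i)%:E * \d_((((lam i)^-1 *: x i)%R : borel_space R d)) A) &
          moment_solution X g mu].
Proof.
move=> gi g X X_bounded slater.
have boundE (mu : probability (borel_space R d) R) (v : R) : mu X = 1 ->
    (forall i x, X x -> v%:E <= gi i x) -> v%:E <= \int[mu]_(x in X) g x.
  move=> muX vg; apply: moment_lower_bound => // x Xx.
  have [i [j E]] := min_fun_attained a b m_gt0 n_gt0 x.
  by apply/bigmin_geP; split=> [|i' _]; [exact: leey|exact: vg].
have lowE : lower_value gi c = moment_value X g.
  apply/le_anti/andP; split.
    apply: le_ereal_inf_tmp => _ [mu muX <-].
    (* A point of [X] excludes [lower_value gi c = +oo], since every [gi i] is finite there. *)
    have [x0 Xx0] : X !=set0.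
      apply/set0P/eqP => X0; move: muX; rewrite /probabilities_on /= X0 measure0.
      by move=> /eqP; rewrite eq_sym onee_eq0.
    have lowg i x : X x -> lower_value gi c <= gi i x by exact: lower_value_le.
    case: (lower_value gi c) lowg => [v lowg||_]; last exact: leNye.
      exact: boundE.
    move=> /(_ (Ordinal m_gt0) x0 Xx0).
    have [j E] := max_affine_attained (a (Ordinal m_gt0)) (b (Ordinal m_gt0)) x0 n_gt0.
    by rewrite /gi E.
  apply: le_ereal_inf_tmp => _ [eta [lam [x [feas ->]]]].
  have [mu _ [muX]] := feasible_measure m_gt0 n_gt0 c_proper c_closed c_convex X_bounded feas.
  by apply: le_trans; apply: ereal_inf_lbound; exists mu.
split=> // [|eta lam x [feas sol]].
  apply/le_anti/andP; split; last first.
    apply: ge_ereal_sup => _ [w feas <-].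
    apply: le_ereal_inf_tmp => _ [mu muX <-]; apply: boundE => // i x Xx.
    exact: upper_feasible_le feas Xx.
  (* Any real [v] below the moment value, which is the lower value, is strictly below each [gi i] on
     [X]. *)
  apply: lee_lt_real => v v_lt; apply: upper_value_ge => // i x Xx.
  by rewrite (lt_le_trans v_lt)// -lowE; exact: lower_value_le.
have [mu muE [muX le_eta]] :=
  feasible_measure m_gt0 n_gt0 c_proper c_closed c_convex X_bounded feas.
(* Optimality turns [le_eta] into the upper bound by the moment value; the infimum gives the other
   one. *)
exists mu => //; split=> //; apply/le_anti/andP; split.
  by rewrite -lowE -sol.
by apply: ereal_inf_lbound; exists mu.
Qed.
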